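(* Let $(M,d)$ be a complete pointed metric space with base point $0$, and let $\mu$ be a positive Radon measure on $\beta\widetilde{M}$ that is $\preccurlyeq$-minimal and concentrated on $d^{-1}[0,\infty)$. Then $p_1(\operatorname{supp}\mu)\cup p_2(\operatorname{supp}\mu)\subset \operatorname{esupp}(\Phi^*\mu)\cup\{0\}$.
   Context: $\mathrm{Lip}_0(M)$: Lipschitz $f:M\to\mathbb{R}$ with $f(0)=0$ normed by the Lipschitz constant. $\widetilde{M}=\{(x,y)\in M\times M:x\ne y\}$, $\beta\widetilde{M}$ its Stone–Čech compactification; Radon measures on it are identified with $C(\beta\widetilde{M})^*$ and $\operatorname{supp}\mu$ is the usual (closed) support. $d:\beta\widetilde{M}\to[0,\infty]$ is the continuous extension of $(x,y)\mapsto d(x,y)$. $\Phi:\mathrm{Lip}_0(M)\to C(\beta\widetilde{M})$ maps $f$ to the continuous extension of $(x,y)\mapsto(f(x)-f(y))/d(x,y)$, $\Phi^*:C(\beta\widetilde{M})^*\to\mathrm{Lip}_0(M)^*$ its adjoint. $M^u$ is the uniform (Samuel) compactification of $M$; $p_1,p_2:\beta\widetilde{M}\to M^u$ are the continuous extensions of $(x,y)\mapsto x$, $(x,y)\mapsto y$. For $\psi\in\mathrm{Lip}_0(M)^*$, its extended support is $\operatorname{esupp}(\psi)=\bigcap\{\overline{A}^{M^u}: A\subset M$ and $\langle f,\psi\rangle=0$ whenever $f\in\mathrm{Lip}_0(M)$ and $f|_A=0\}$. $G$ is the set of $g\in C(\beta\widetilde{M})$ with $d(x,y)g(x,y)\le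 d(x,u)g(x,u)+d(u,y)g(u,y)$ for distinct $x,u,y\in M$; $\mu\preccurlyeq\nu$ iff $\int g\,d\mu\le\int g\,d\nu$ for all $g\in G$; $\mu$ is $\preccurlyeq$-minimal if every positive $\nu\preccurlyeq\mu$ satisfies $\mu\preccurlyeq\nu$. Throughout, $M$ has at least three distinct points. *)

(* Defs.v *)
From HB Require Import structures.
From mathcomp Require Import all_boot all_order all_algebra.
From mathcomp Require Import all_classical all_reals all_analysis.
Set Implicit Arguments. Unset Strict Implicit. Unset Printing Implicit Defensive.
Import Order.TTheory GRing.Theory Num.Theory numFieldNormedType.Exports.
Local Open Scope classical_set_scope.
Local Open Scope ring_scope.

Definition is_metric (R : realType) (M : Type) (d : M -> M -> R) : Prop :=
  (forall x y, 0 <= d x y) /\ (forall x y, d x y = 0 <-> x = y) /\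
  (forall x y, d x y = d y x) /\ (forall x y z, d x z <= d x y + d y z).

Definition metric_complete (R : realType) (M : Type) (d : M -> M -> R) : Prop :=
  forall u : nat -> M,
    (forall e : R, 0 < e -> exists N, forall m n, (N <= m)%N -> (N <= n)%N -> d (u m) (u n) < e) ->
    exists l : M, forall e : R, 0 < e -> exists N, forall n, (N <= n)%N -> d (u n) l < e.

Definition Lip0 (R : realType) (M : Type) (d : M -> M -> R) (z : M) (f : M -> R) : Prop :=
  f z = 0 /\ exists L : R, forall x y, `|f x - f y| <= L * d x y.

(* continuity / boundedness of a function on Mtilde = {(x,y) : x <> y},
   with the product metric topology; functions on Mtilde are represented
   as curried functions M -> M -> _ whose values on the diagonal are irrelevant *)
Definition tilde_bounded (R : realType) (M : Type) (h : M -> M -> R) : Prop :=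
  exists C : R, forall x y, x <> y -> `|h x y| <= C.

Definition tilde_continuous (R : realType) (M : Type) (d : M -> M -> R)
  (T : topologicalType) (h : M -> M -> T) : Prop :=
  forall x y, x <> y -> forall V, nbhs (h x y) V ->
    exists2 del : R, 0 < del & forall x' y', x' <> y' -> d x x' < del -> d y y' < del -> V (h x' y').

Definition M_continuous (R : realType) (M : Type) (d : M -> M -> R)
  (T : topologicalType) (h : M -> T) : Prop :=
  forall x V, nbhs (h x) V ->
    exists2 del : R, 0 < del & forall x', d x x' < del -> V (h x').

Definition unif_continuous (R : realType) (M : Type) (d : M -> M -> R) (h : M -> R) : Prop :=
  forall e : R, 0 < e -> exists2 del : R, 0 < del &
    forall x y, d x y < del -> `|h x - h y| < e.

Definition M_bounded (R : realType) (M : Type) (h : M -> R) : Prop :=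
  exists C : R, forall x, `|h x| <= C.

(* ---------- the Stone-Cech compactification of Mtilde ----------
   (B, iota) is (a model of) beta Mtilde: B compact Hausdorff, iota : Mtilde -> B
   continuous with dense range, and every bounded continuous real function on
   Mtilde extends continuously to B.  These properties characterize beta Mtilde
   up to a homeomorphism fixing Mtilde. *)
Definition is_stone_cech (R : realType) (M : Type) (d : M -> M -> R)
  (B : topologicalType) (iota : M -> M -> B) : Prop :=
  compact [set: B] /\ hausdorff_space B /\
  tilde_continuous d iota /\
  closure [set b | exists x y, x <> y /\ b = iota x y] = [set: B] /\
  (forall h : M -> M -> R, tilde_bounded h -> tilde_continuous d h ->
     exists H : B -> R, continuous H /\ forall x y, x <> y -> H (iota x y) = h x y).

Definition is_samuel (R : realType) (M : Type) (d : M -> M -> R)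
  (U : topologicalType) (j : M -> U) : Prop :=
  compact [set: U] /\ hausdorff_space U /\
  M_continuous d j /\
  closure (range j) = [set: U] /\
  (forall H : U -> R, continuous H -> unif_continuous d (H \o j)) /\
  (forall h : M -> R, M_bounded h -> unif_continuous d h ->
     exists H : U -> R, continuous H /\ forall x, H (j x) = h x).

(* a positive Radon measure on the compact space B, identified with a positive
   linear functional on C(B); mu g stands for \int g dmu (values of mu on
   non-continuous functions are irrelevant) *)
Definition pos_radon (R : realType) (B : topologicalType) (mu : (B -> R) -> R) : Prop :=
  (forall f g : B -> R, continuous f -> continuous g ->
     mu (fun b => f b + g b) = mu f + mu g) /\
  (forall (a : R) (f : B -> R), continuous f -> mu (fun b => a * f b) = a * mu f) /\
  (forall f : B -> R, continuous f -> (forall b, 0 <= f b) -> 0 <= mu f).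

(* the (closed) support: b is in supp mu iff every open neighbourhood V of b
   has positive measure, i.e. carries a continuous 0 <= f supported in V
   with \int f dmu > 0 *)
Definition supp (R : realType) (B : topologicalType) (mu : (B -> R) -> R) : set B :=
  [set b | forall V : set B, open V -> V b ->
     exists f : B -> R, [/\ continuous f, (forall c, 0 <= f c),
                          (forall c, ~ V c -> f c = 0) & 0 < mu f]].

(* mu is concentrated on dB^-1[0,oo), i.e. the closed set F = dB^-1{+oo} is
   mu-null; for a Radon measure mu(F) = inf { \int f dmu : f in C(B), f >= 1_F } *)
Definition concentrated_finite (R : realType) (B : topologicalType)
  (dB : B -> \bar R) (mu : (B -> R) -> R) : Prop :=
  forall e : R, 0 < e -> exists f : B -> R,
    [/\ continuous f, (forall c, 0 <= f c), (forall c, dB c = +oo%E -> 1 <= f c) & mu f < e].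

Definition Gset (R : realType) (M : Type) (d : M -> M -> R) (B : topologicalType)
  (iota : M -> M -> B) (g : B -> R) : Prop :=
  continuous g /\
  forall x u y, x <> u -> u <> y -> x <> y ->
    d x y * g (iota x y) <= d x u * g (iota x u) + d u y * g (iota u y).

Definition Gle (R : realType) (M : Type) (d : M -> M -> R) (B : topologicalType)
  (iota : M -> M -> B) (mu nu : (B -> R) -> R) : Prop :=
  forall g, Gset d iota g -> mu g <= nu g.

Definition Gminimal (R : realType) (M : Type) (d : M -> M -> R) (B : topologicalType)
  (iota : M -> M -> B) (mu : (B -> R) -> R) : Prop :=
  forall nu, pos_radon nu -> Gle d iota nu mu -> Gle d iota mu nu.

Definition esupp (R : realType) (M : Type) (d : M -> M -> R) (z : M)
  (U : topologicalType) (j : M -> U) (psi : (M -> R) -> R) : set U :=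
  [set u | forall A : set M,
     (forall f, Lip0 d z f -> (forall a, A a -> f a = 0) -> psi f = 0) ->
     closure (j @` A) u].

(* Main.v *)
Require Import Defs.
From HB Require Import structures.
From mathcomp Require Import all_boot all_order all_algebra.
From mathcomp Require Import all_classical all_reals all_analysis.
From mathcomp Require Import ring lra.
Import Order.TTheory GRing.Theory Num.Theory numFieldNormedType.Exports.
Local Open Scope classical_set_scope.
Local Open Scope ring_scope.

(* By Hahn-Banach, a minimal [mu] satisfies: for every [g] in [G] and [e > 0] there
   is [g'] in [G] with [g' >= - g] and [mu g' < - mu g + e].  Suppose [Phi^* mu]
   vanishes on the Lipschitz functions vanishing on [A], with [A z], and [g <= 0] on
   pairs of points of [A].  Then [f x = inf_(a in A) d x a * g' (x, a)] is a Lipschitz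
   function vanishing on [A] with [Phi f <= g'], so [0 = mu (Phi f) <= mu g'];
   letting [e] tend to [0], [mu g <= 0].  Applied to
   [g (x, y) = min (1, (d(x, A) + d(y, A)) / d(x, y))], this shows that the
   nonnegative [g] vanishes on the support of [mu].  But [g > 0] at every point of
   finite distance one of whose coordinates lies outside the closure of [A] in [U]. *)

(** * Sublinear functionals and the Hahn-Banach theorem *)

Section HahnBanach.
Context {R : realType} {V : lmodType R}.
Implicit Types (p q : V -> R) (x y : V).

Definition sublinear p : Prop :=
  (forall x y, p (x + y) <= p x + p y) /\
  (forall (a : R) x, 0 < a -> p (a *: x) <= a * p x).

Lemma sublinearZ p (a : R) x : sublinear p -> 0 < a -> p (a *: x) = a * p x.
Proof.
move=> [_ pZ] a0; apply/eqP; rewrite eq_le pZ//= -ler_pdivlMl//.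
by apply: le_trans (pZ _ _ _); rewrite ?invr_gt0// scalerK// gt_eqF.
Qed.

Lemma sublinear0 p : sublinear p -> p 0 = 0.
Proof.
move=> sp; have := sublinearZ p 2 0 sp (ltr0n _ 2); rewrite scaler0; lra.
Qed.

Lemma sublinearN p x : sublinear p -> - p (- x) <= p x.
Proof.
move=> sp; have := sp.1 x (- x); rewrite subrr sublinear0//; lra.
Qed.

Lemma inf_le_mem (E : set R) (m e : R) : lbound E m -> E e -> inf E <= e.
Proof. by move=> mE Ee; apply: ge_inf => //; exists m. Qed.

(** Zorn's lemma for the reversed pointwise order. The infimum of a chain is finite, being at least
    [- p (- x)], and it stays subadditive because the smaller of two members of the chain serves
    both arguments. *)
Lemma sublinear_le_minimal p : sublinear p -> exists q,
  [/\ sublinear q, forall x, q x <= p x &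
      forall q', sublinear q' -> (forall x, q' x <= q x) -> q' = q].
Proof.
move=> sp.
pose T := {q : V -> R | sublinear q /\ forall x, q x <= p x}.
pose r (s t : T) := `[< forall x, sval t x <= sval s x >].
have [|s1 s2 s3 /asboolP h1 /asboolP h2|s t /asboolP h1 /asboolP h2|A Atot|t tmin] := @Zorn T r.
- by move=> t; apply/asboolP.
- by apply/asboolP => x; apply: le_trans (h1 x).
- case: s t h1 h2 => [s sP] [t tP] /= h1 h2.
  have E : s = t by apply/funext => x; apply/eqP; rewrite eq_le h1 h2.
  by case: _ / E tP {h1 h2} => tP; congr exist; exact: Prop_irrelevance.
- have [[a Aa]|A0] := pselect (A !=set0); last first.
    have pT : sublinear p /\ forall x, p x <= p x by split.
    by exists (exist _ p pT) => s As; case: A0; exists s.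
  pose E x := [set sval s x | s in A].
  have Elb x : lbound (E x) (- p (- x)).
    move=> _ [s As <-]; apply: le_trans (sublinearN _ _ (svalP s).1).
    by rewrite lerN2; exact: (svalP s).2.
  pose q x := inf (E x).
  have qle s x : A s -> q x <= sval s x.
    by move=> As; apply: inf_le_mem (Elb x) _; exists s.
  have leq_q x c : (forall s, A s -> c <= sval s x) -> c <= q x.
    by move=> h; apply: lb_le_inf; [exists (sval a x); exists a|move=> _ [s /h ? <-]].
  have sq : sublinear q.
    split=> [x y|k x k0].
      rewrite -lerBlDr; apply: (leq_q) => s1 As1; rewrite lerBlDl -lerBlDr.
      apply: (leq_q) => s2 As2; rewrite lerBlDr.
      have [s [As h1 h2]] : exists s, [/\ A s, sval s x <= sval s1 x & sval s y <= sval s2 y].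
        have [/asboolP h|/asboolP h] := Atot _ _ As1 As2.
          by exists s2; split => //.
        by exists s1; split => //.
      apply: le_trans (qle _ _ As) _; apply: le_trans ((svalP s).1.1 _ _) _.
      by rewrite addrC; exact: lerD.
    rewrite -ler_pdivrMl//; apply: (leq_q) => s As; rewrite ler_pdivrMl//.
    by apply: le_trans (qle _ _ As) _; exact: (svalP s).1.2.
  have qT : sublinear q /\ forall x, q x <= p x.
    by split => // x; apply: le_trans (qle _ x Aa) _; exact: (svalP a).2.
  by exists (exist _ q qT) => s As; apply/asboolP => x; exact: qle.
- exists (sval t); split; [exact: (svalP t).1|exact: (svalP t).2|].
  move=> q' sq' q'le.
  have q'T : sublinear q' /\ forall x, q' x <= p x.
    by split => // x; apply: le_trans (q'le x) _; exact: (svalP t).2.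
  have := tmin (exist _ q' q'T); rewrite /r => <-//=.
  exact/asboolP.
Qed.

(** Take [q y = inf_(t >= 0) (p (y + t *: x) - t * p x)]: [t = 0] gives [q <= p], and [t = 1] at
    [y = - x] gives the last bound. *)
Lemma sublinear_tilt p x : sublinear p -> exists q,
  [/\ sublinear q, forall y, q y <= p y & q (- x) <= - p x].
Proof.
move=> sp.
have pZ0 (t : R) : 0 <= t -> p (t *: x) = t * p x.
  rewrite le_eqVlt => /predU1P[<-|]; first by rewrite scale0r mul0r sublinear0.
  exact: sublinearZ.
pose E y := [set p (y + t *: x) - t * p x | t in [set t : R | 0 <= t]].
have Elb y : lbound (E y) (- p (- y)).
  move=> _ [t /= t0 <-]; have := sp.1 (y + t *: x) (- y).
  by rewrite addrAC subrr add0r pZ0//; lra.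
pose q y := inf (E y).
have qle t y : 0 <= t -> q y <= p (y + t *: x) - t * p x.
  by move=> t0; apply: inf_le_mem (Elb y) _; exists t.
have leq_q y c : (forall t, 0 <= t -> c <= p (y + t *: x) - t * p x) -> c <= q y.
  move=> h; apply: lb_le_inf; first by exists (p (y + 0 *: x) - 0 * p x); exists 0 => //=.
  by move=> _ [t /= t0 <-]; exact: h.
exists q; split.
- split=> [y1 y2|a y a0].
    rewrite -lerBlDr; apply: (leq_q) => t1 t10; rewrite lerBlDl -lerBlDr.
    apply: (leq_q) => t2 t20; rewrite lerBlDr.
    apply: le_trans (qle (t1 + t2) _ _) _; first exact: addr_ge0.
    have -> : y1 + y2 + (t1 + t2) *: x = (y1 + t1 *: x) + (y2 + t2 *: x).
      by rewrite scalerDl addrACA.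
    have := sp.1 (y1 + t1 *: x) (y2 + t2 *: x); lra.
  rewrite -ler_pdivrMl//; apply: (leq_q) => t t0; rewrite ler_pdivrMl//.
  apply: le_trans (qle (a * t) _ _) _; first by rewrite mulr_ge0// ltW.
  by rewrite -scalerA -scalerDr sublinearZ// mulrBr mulrA.
- by move=> y; have := qle 0 y (lexx _); rewrite scale0r addr0 mul0r subr0.
- by have := qle 1 (- x) ler01; rewrite scale1r addNr sublinear0// mul1r sub0r.
Qed.

(** Tilting [p] at [k] forces equality at [k] for everything linear below the tilt. A minimal
    sublinear functional below it equals each of its own tilts, hence is odd, and an odd sublinear
    functional is linear. *)
Lemma hahn_banach_attained p k : sublinear p -> exists nu : V -> R,
  [/\ forall x y, nu (x + y) = nu x + nu y, forall a x, nu (a *: x) = a * nu x,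
      forall x, nu x <= p x & nu k = p k].
Proof.
move=> sp; have [pk [spk pk_le pkN]] := sublinear_tilt p k sp.
have [q [sq q_le qmin]] := sublinear_le_minimal pk spk.
have qN x : q (- x) = - q x.
  have [q' [sq' q'_le q'N]] := sublinear_tilt q x sq.
  apply/eqP; rewrite eq_le -{1}(qmin q')// q'N/=.
  by rewrite lerNl; exact: sublinearN.
exists q; split.
- move=> x y; apply/eqP; rewrite eq_le sq.1/=.
  by rewrite -lerN2 opprD -!qN opprD; exact: sq.1.
- move=> a x; have [a0|a0|->] := ltgtP a 0; last by rewrite scale0r mul0r sublinear0.
    by have := sublinearZ q (- a) x sq; rewrite oppr_gt0 scaleNr qN => /(_ a0); lra.
  exact: sublinearZ.
- by move=> x; exact: le_trans (q_le x) (pk_le x).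
- apply/eqP; rewrite eq_le (le_trans (q_le _) (pk_le _))/=.
  by rewrite -lerN2 -qN (le_trans (q_le _)).
Qed.
End HahnBanach.

(** * The module of continuous functions, and positive functionals on it *)

Section ContinuousFunctions.
Context {R : realType} {B : topologicalType}.
Implicit Types f g : B -> R.

Definition cont : {pred (B -> R^o)} := [pred f | `[< continuous f >]].

Lemma cont_submod_closed : submod_closed cont.
Proof.
split; first by apply/asboolP => x; exact: cvg_cst.
move=> a f g /asboolP cf /asboolP cg; apply/asboolP => x.
by apply: cvgD; [apply: cvgM; [exact: cvg_cst|exact: cf]|exact: cg].
Qed.

HB.instance Definition _ := GRing.isSubmodClosed.Build _ _ cont cont_submod_closed.

Record cfun := CFun { cfun_val :> B -> R^o ; cfunP : cfun_val \in cont }.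

HB.instance Definition _ := [isSub for cfun_val].
HB.instance Definition _ := [Choice of cfun by <:].
HB.instance Definition _ := [SubChoice_isSubLmodule of cfun by <:].

Lemma cfun_continuous (k : cfun) : continuous (k : B -> R).
Proof. exact/asboolP/cfunP. Qed.

Definition cfun_of f (cf : continuous f) : cfun := @CFun f (asboolT cf).

Lemma continuous_lin (a : R) f g : continuous f -> continuous g ->
  continuous (fun b => a * f b + g b).
Proof.
by move=> cf cg x; apply: cvgD; [apply: cvgM; [exact: cvg_cst|exact: cf]|exact: cg].
Qed.

Lemma continuous_bounded f : compact [set: B] -> continuous f ->
  exists2 C, 0 <= C & forall b, `|f b| <= C.
Proof.
move=> cB cf; have [[b0 _]|B0] := pselect ([set: B] !=set0); last first.
  by exists 0 => // b; case: B0; exists b.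
have cnf : continuous (fun b => `|f b|) by move=> x; apply: cvg_norm; exact: cf.
have B0 : [set: B] !=set0 by exists b0.
have [c _ cmax] := compact_EVT_max B0 cB (continuous_subspaceT cnf).
by exists `|f c| => // b; apply: cmax; rewrite inE.
Qed.

Section PosRadon.
Context {mu : (B -> R) -> R} (mu_pos : pos_radon mu).

Lemma pos_radon_lin (a : R) f g : continuous f -> continuous g ->
  mu (fun b => a * f b + g b) = a * mu f + mu g.
Proof.
case: mu_pos => muD [muZ _] cf cg; rewrite muD ?muZ//.
by move=> x; apply: cvgM; [exact: cvg_cst|exact: cf].
Qed.

Lemma pos_radon_le f g : continuous f -> continuous g ->
  (forall b, f b <= g b) -> mu f <= mu g.
Proof.
move=> cf cg fg; have := pos_radon_lin (-1) f g cf cg.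
have := mu_pos.2.2 _ (continuous_lin (-1) f g cf cg).
move=> + E; rewrite E; suff h : forall b, 0 <= -1 * f b + g b by move=> /(_ h); lra.
by move=> b; have := fg b; lra.
Qed.

End PosRadon.
End ContinuousFunctions.

(** * The cone [Gset] and minimal measures *)

Section Minimal.
Context {R : realType} {M : Type} {d : M -> M -> R} {B : topologicalType}.
Context {iota : M -> M -> B}.
Hypothesis dm : is_metric d.
Implicit Types (g : B -> R) (mu : (B -> R) -> R).

Lemma Gset_lin (a : R) g1 g2 : 0 <= a -> Gset d iota g1 -> Gset d iota g2 ->
  Gset d iota (fun b => a * g1 b + g2 b).
Proof.
move=> a0 [c1 t1] [c2 t2]; split; first exact: continuous_lin.
move=> x u y xu uy xy; have := t2 _ _ _ xu uy xy.
by have /(ler_wpM2l a0) := t1 _ _ _ xu uy xy; lra.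
Qed.

Lemma Gset_cst (c : R) : 0 <= c -> Gset d iota (fun=> c).
Proof.
move=> c0; split; first by move=> x; exact: cvg_cst.
move=> x u y _ _ _; rewrite -mulrDl ler_wpM2r//.
by case: dm => _ [_ [_]]; exact.
Qed.

(** Let [P k] be the infimum of [mu g'] over the [g'] in the cone that dominate [k]. A linear
    [nu <= P] attaining [P] at [- g] is a positive measure with [nu] below [mu], so minimality gives
    [mu g <= nu g = - P (- g)]; a near-minimizer for [P (- g)] is the required [g']. *)
Lemma Gminimal_dominating mu g (e : R) : compact [set: B] -> pos_radon mu ->
  Gminimal d iota mu -> Gset d iota g -> 0 < e ->
  exists g', [/\ Gset d iota g', forall b, - g b <= g' b & mu g' < - mu g + e].
Proof.
move=> cB mu_pos mu_min Gg e0.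
pose E (k : cfun) := [set mu g' | g' in [set g' | Gset d iota g' /\ forall b, k b <= g' b]].
pose P (k : cfun) := inf (E k).
have E0 k : E k !=set0.
  have [C C0 kC] := continuous_bounded _ cB (cfun_continuous k).
  exists (mu (fun=> C)), (fun=> C) => //; split; first exact: Gset_cst.
  by move=> b; apply: le_trans (kC b); exact: ler_norm.
have Elb k : lbound (E k) (mu k).
  move=> _ [g' [Gg' kg'] <-]; apply: (pos_radon_le mu_pos) => //; last exact: Gg'.1.
  exact: cfun_continuous.
have Ple (k : cfun) g' : Gset d iota g' -> (forall b, k b <= g' b) -> P k <= mu g'.
  by move=> Gg' kg'; apply: inf_le_mem (Elb k) _; exists g'.
have leP (k : cfun) c : (forall g', Gset d iota g' -> (forall b, k b <= g' b) -> c <= mu g') ->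
    c <= P k.
  by move=> h; apply: lb_le_inf => // _ [g' [? ?] <-]; exact: h.
have sP : sublinear P.
  split=> [k1 k2|a k a0].
    rewrite -lerBlDr; apply: (leP) => g1 Gg1 kg1; rewrite lerBlDl -lerBlDr.
    apply: (leP) => g2 Gg2 kg2; rewrite lerBlDr [leRHS]addrC -[mu g1]mul1r.
    rewrite -(pos_radon_lin mu_pos); [|exact: Gg1.1|exact: Gg2.1].
    apply: Ple; first exact: Gset_lin.
    by move=> b /=; rewrite mul1r; exact: lerD.
  rewrite -ler_pdivrMl//; apply: (leP) => g' Gg' kg'; rewrite ler_pdivrMl//.
  have -> : a * mu g' = mu (fun b => a * g' b) by rewrite mu_pos.2.1//; exact: Gg'.1.
  apply: Ple => [|b /=]; last by rewrite ler_pM2l.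
  have := Gset_lin a g' (fun=> 0) (ltW a0) Gg' (Gset_cst 0 (lexx _)).
  by under eq_fun do rewrite addr0.
pose k : cfun := - cfun_of g Gg.1.
have [nu [nuD nuZ nuP nuk]] := hahn_banach_attained P k sP.
(* A measure is a functional on all functions, so [nu] gets the junk value 0 off the continuous
   ones. *)
pose nu' (f : B -> R) := if pselect (continuous f) is left cf then nu (cfun_of f cf) else 0.
have nu'E (h : cfun) (f : B -> R) : (forall b, f b = h b) -> nu' f = nu h.
  move=> /funext ->; rewrite /nu'; case: pselect => [cf|]; last first.
    by case; exact: cfun_continuous.
  by congr nu; apply: val_inj.
have nu'_pos : pos_radon nu'.
  split; [|split].
  - move=> f1 f2 c1 c2; rewrite (nu'E (cfun_of f1 c1 + cfun_of f2 c2))//.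
    by rewrite nuD (nu'E (cfun_of f1 c1))// (nu'E (cfun_of f2 c2)).
  - move=> a f cf; rewrite (nu'E (a *: cfun_of f cf))// nuZ.
    by rewrite (nu'E (cfun_of f cf)).
  - move=> f cf f0; rewrite (nu'E (cfun_of f cf))//.
    (* The zero function lies in the cone and dominates [- f], so [P (- f) <= mu 0 = 0]; writing 0
       as [0 * 0] lets homogeneity evaluate [mu 0]. *)
    have : nu (- cfun_of f cf) <= 0.
      apply: le_trans (nuP _) _; have <- : mu (fun=> 0 * 0) = 0.
        by rewrite mu_pos.2.1 ?mul0r// => x; exact: cvg_cst.
      apply: Ple => [|b /=]; first by rewrite mulr0; exact: Gset_cst.
      by rewrite mulr0 oppr_le0.
    by rewrite -scaleN1r nuZ; lra.
have /mu_min/(_ g Gg) : Gle d iota nu' mu.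
  move=> h Gh; rewrite (nu'E (cfun_of h Gh.1))//.
  by apply: le_trans (nuP _) _; exact: Ple.
rewrite (nu'E (cfun_of g Gg.1))//.
have -> : nu (cfun_of g Gg.1) = - P k.
  by rewrite -nuk /k -[- cfun_of _ _]scaleN1r nuZ mulN1r opprK.
rewrite lerNr => Pk; have [_ [g' [Gg' kg'] <-] g'lt] := inf_adherent e0 (conj (E0 k) (ex_intro _ _ (Elb k))).
exists g'; split; [by []|exact: kg'|]; apply: lt_le_trans g'lt _.
by rewrite lerD2r; exact: Pk.
Qed.
End Minimal.

(** * Elements of the cone and Lipschitz functions on the Stone-Cech compactification *)

Section StoneCech.
Context {R : realType} {M : Type} {d : M -> M -> R} {B : topologicalType}.
Context {iota : M -> M -> B}.
Hypotheses (dm : is_metric d) (sc : is_stone_cech d iota).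

Lemma stone_cech_nonempty_open (W : set B) : open W -> W !=set0 ->
  exists x y, x <> y /\ W (iota x y).
Proof.
move=> oW [c Wc]; have : closure [set b | exists x y, x <> y /\ b = iota x y] c.
  by rewrite sc.2.2.2.1.
by move=> /(_ W (open_nbhs_nbhs (conj oW Wc)))[_ [[x [y [xy ->]]] Wxy]]; exists x, y.
Qed.

(** Otherwise [W] meets the open set where [h < c], and by density the intersection contains some
    [iota x y]. *)
Lemma stone_cech_ge (W : set B) (h : B -> R) (c : R) (b : B) : continuous h -> open W ->
  (forall x y, x <> y -> W (iota x y) -> c <= h (iota x y)) -> W b -> c <= h b.
Proof.
move=> ch oW hW Wb; rewrite leNgt; apply/negP => hbc.
have oV : open (W `&` h @^-1` [set r | r < c]).
  by apply: openI => //; apply: open_comp; [move=> x _; exact: ch|exact: open_lt].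
have [|x [y [xy [/(hW _ _ xy) + /=]]]] := stone_cech_nonempty_open _ oV.
  by exists b.
by rewrite leNgt => /negP.
Qed.

(** Values of [g] at [iota x x] are harmless since [d x x = 0]. The one nontrivial degenerate case
    is [x = y], and there the three distinct points are used. *)
Lemma Gset_triangle (g : B -> R) x u y : (exists p q r : M, [/\ p <> q, q <> r & p <> r]) ->
  Gset d iota g ->
  d x y * g (iota x y) <= d x u * g (iota x u) + d u y * g (iota u y).
Proof.
move=> [p [q [r [pq qr pr]]]] [_ tri]; have [_ [d0 _]] := dm.
have dd a : d a a = 0 by apply/d0.
have [->|xu] := pselect (x = u); first by rewrite dd mul0r add0r.
have [->|uy] := pselect (u = y); first by rewrite dd mul0r addr0.
have [<-{y uy}|xy] := pselect (x = y); last exact: tri.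
(* through a third point [v], both [D x v <= D x u + D u v] and [D u v <= D u x + D x v] *)
have [v [xv uv]] : exists v, x <> v /\ u <> v.
  have [xp|xp] := pselect (x = p).
    have [uq|uq] := pselect (u = q); first by exists r; rewrite xp uq.
    by exists q; rewrite xp.
  have [up|up] := pselect (u = p); last by exists p.
  have [xq|xq] := pselect (x = q); first by exists r; rewrite xq up.
  by exists q; rewrite up.
rewrite dd mul0r; have := tri x u v xu uv xv.
by have := tri u x v (nesym xu) xv uv; lra.
Qed.

Context {z : M} {Phi : (M -> R) -> (B -> R)}.
Hypothesis Phi_ext : forall f, Lip0 d z f -> continuous (Phi f) /\
  forall x y, x <> y -> Phi f (iota x y) = (f x - f y) / d x y.

Lemma metric_gt0 x y : x <> y -> 0 < d x y.
Proof.
move=> xy; rewrite lt_neqAle dm.1 andbT eq_sym; apply/eqP => d0.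
by apply: xy; apply/dm.2.1.
Qed.

(** With [D x y = d x y * g (iota x y)], the function [f x = inf_(a in A) D x a] satisfies
    [f x - f y <= D x y] by the triangle inequality for [D]. Boundedness of [g] makes it Lipschitz,
    the sign of [g] on [A] makes it vanish there, and density extends [Phi f <= g] to [B]. *)
Lemma Gset_subordinate_Lip0 (A : set M) (g : B -> R) :
  (exists p q r : M, [/\ p <> q, q <> r & p <> r]) ->
  Gset d iota g -> A z -> (forall a b, A a -> A b -> a <> b -> 0 <= g (iota a b)) ->
  exists f, [/\ Lip0 d z f, forall a, A a -> f a = 0 & forall b, Phi f b <= g b].
Proof.
move=> M3 Gg Az gA; have [dpos [d0 [dsym _]]] := dm.
have dd a : d a a = 0 by apply/d0.
pose D x y := d x y * g (iota x y).
have tri x u y : D x y <= D x u + D u y by exact: Gset_triangle.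
have Dxx x : D x x = 0 by rewrite /D dd mul0r.
have DA a b : A a -> A b -> 0 <= D a b.
  move=> Aa Ab; have [->|ab] := pselect (a = b); first by rewrite Dxx.
  by rewrite mulr_ge0// gA.
have [C C0 gC] := continuous_bounded _ sc.1 Gg.1.
have DC x y : D x y <= C * d x y.
  by rewrite /D mulrC ler_wpM2r//; apply: le_trans (gC (iota x y)); exact: ler_norm.
pose E x := [set D x a | a in A].
(* Finiteness of the infimum: [0 <= D z a <= D z x + D x a]. *)
have Elb x : lbound (E x) (- D z x).
  move=> _ [a Aa <-]; have := tri z x a; have := DA z a Az Aa; lra.
pose f x := inf (E x).
have fle x a : A a -> f x <= D x a.
  by move=> Aa; apply: inf_le_mem (Elb x) _; exists a.
have lef x c : (forall a, A a -> c <= D x a) -> c <= f x.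
  move=> h; apply: lb_le_inf; first by exists (D x z), z.
  by move=> _ [a Aa <-]; exact: h.
have fA a : A a -> f a = 0.
  move=> Aa; apply/eqP; rewrite eq_le; apply/andP; split.
    by rewrite -(Dxx a); exact: fle.
  by apply: lef => b Ab; exact: DA.
have fD x y : f x - f y <= D x y.
  rewrite lerBlDr -lerBlDl; apply: (lef) => a Aa; rewrite lerBlDl.
  by apply: le_trans (fle _ _ Aa) _; exact: tri.
have Lf : Lip0 d z f.
  split; [exact: fA|exists C => x y]; rewrite ler_norml.
  have := le_trans (fD x y) (DC x y); have := le_trans (fD y x) (DC y x).
  by rewrite (dsym y x) => h1 h2; apply/andP; split; lra.
exists f; split => // b.
have [cP PE] := Phi_ext f Lf.
have := @stone_cech_ge setT (fun b => -1 * Phi f b + g b) 0 b.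
have -> : 0 <= -1 * Phi f b + g b = (Phi f b <= g b) by rewrite mulN1r addrC subr_ge0.
apply => //; [exact: continuous_lin cP Gg.1|exact: openT|].
move=> x y xy _; rewrite mulN1r addrC subr_ge0 PE// ler_pdivrMr ?metric_gt0//.
by rewrite mulrC; exact: fD.
Qed.

Lemma Gminimal_nonpos (mu : (B -> R) -> R) (A : set M) (g : B -> R) :
  (exists p q r : M, [/\ p <> q, q <> r & p <> r]) ->
  pos_radon mu -> Gminimal d iota mu -> A z ->
  (forall f, Lip0 d z f -> (forall a, A a -> f a = 0) -> mu (Phi f) = 0) ->
  Gset d iota g -> (forall a b, A a -> A b -> a <> b -> g (iota a b) <= 0) ->
  mu g <= 0.
Proof.
move=> M3 mu_pos mu_min Az muA Gg gA; rewrite leNgt; apply/negP => mug.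
(* With the error chosen as [mu g] itself, this reads [mu g' < 0]. *)
have [g' [Gg' gg' mug']] := Gminimal_dominating dm _ _ _ sc.1 mu_pos mu_min Gg mug.
have [|f [Lf fA fg']] := Gset_subordinate_Lip0 A g' M3 Gg' Az.
  move=> a b Aa Ab ab; apply: le_trans (gg' _).
  by rewrite oppr_ge0; exact: gA.
have := pos_radon_le mu_pos (Phi f) g' (Phi_ext f Lf).1 Gg'.1 fg'.
by rewrite muA//; lra.
Qed.

End StoneCech.

(** * Supports of measures concentrated on finite distances *)

Section Support.
Context {R : realType} {B : topologicalType}.

(** A test function [f] carried by [V] is dominated by [C * k + eta + L * g], where [k] covers the
    points at infinite distance and has small integral. Since [mu g <= 0], this contradicts
    [0 < mu f]. *)
Lemma supp_disjoint (dB : B -> \bar R) (mu : (B -> R) -> R) (g : B -> R) (V : set B) :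
  compact [set: B] -> pos_radon mu -> concentrated_finite dB mu ->
  continuous g -> (forall b, 0 <= g b) -> mu g <= 0 -> open V ->
  (forall c, V c -> dB c <> +oo%E -> 0 < g c) -> supp mu `&` V = set0.
Proof.
move=> cB mu_pos mu_fin cg g0 mug oV gV; rewrite -subset0 => b [/(_ V oV) + Vb].
move=> /(_ Vb)[f [cf f0 fV muf]].
have [C C0 fC] := continuous_bounded _ cB cf.
have cst_c (r : R) : continuous (fun _ : B => r) by move=> x; exact: cvg_cst.
pose mu1 := mu (fun=> 1).
have mu1_ge0 : 0 <= mu1 by apply: mu_pos.2.2 => //; exact: cst_c.
(* [eta] and [eps] make each of the two error terms at most a third of [mu f]; the added 1 keeps the
   denominators positive. *)
pose eta := mu f / (3 * (mu1 + 1)).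
have eta0 : 0 < eta by rewrite divr_gt0// mulr_gt0//; lra.
have etaE : eta * (mu1 + 1) * 3 = mu f by rewrite /eta; field; lra.
pose eps := mu f / (3 * (C + 1)).
have eps0 : 0 < eps by rewrite divr_gt0// mulr_gt0//; lra.
have epsE : eps * (C + 1) * 3 = mu f by rewrite /eps; field; lra.
have [k [ck k0 k1 muk]] := mu_fin eps eps0.
pose h b := - C * k b + f b.
have ch : continuous h by exact: continuous_lin.
pose K := [set c | eta <= h c].
have cK : compact K.
  apply: (subclosed_compact _ cB) => //.
  by have /continuous_closedP cl := ch; exact: (cl _ (@closed_ge R eta)).
(* On [K] the distance is finite: if it were infinite, [1 <= k c] would give [f c <= C <= C * k c],
   hence [h c <= 0 < eta]. *)
have gK c : K c -> 0 < g c.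
  rewrite /K/= /h => Kc; have kf : 0 <= C * k c by rewrite mulr_ge0.
  apply: gV => [|dc].
    by apply: contrapT => /fV fc; move: Kc; rewrite fc; lra.
  have := ler_norm (f c); have := fC c; have := k1 c dc.
  by move=> /(ler_wpM2l C0); lra.
(* Off [K] the first two terms suffice. On the compact [K], [g] has a positive minimum [g m], so
   [L = C / g m] makes [L * g] at least [C]. *)
have [L L0 fL] : exists2 L, 0 <= L & forall c, f c <= C * k c + eta + L * g c.
  have [K0|K0] := pselect (K !=set0); last first.
    exists 0 => // c; rewrite mul0r addr0 leNgt; apply/negP => lt.
    by apply: K0; exists c; rewrite /K/= /h; lra.
  have [m Km mmin] := compact_EVT_min K0 cK (continuous_subspaceT cg).
  have gm0 : 0 < g m by apply: gK; move: Km; rewrite inE.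
  exists (C / g m) => [|c]; first by rewrite divr_ge0// ltW.
  have [Kc|] := pselect (K c); last first.
    rewrite /K/= /h => /negP; rewrite -ltNge => hc.
    have : 0 <= C / g m * g c by rewrite mulr_ge0// divr_ge0// ltW.
    by lra.
  have : C <= C / g m * g c.
    by rewrite -mulrA ler_peMr// ler_pdivlMl// mulr1 mmin// inE.
  have : 0 <= C * k c by rewrite mulr_ge0.
  by have := ler_norm (f c); have := fC c; lra.
pose F1 := fun _ : B => eta * 1; pose F2 b := L * g b + F1 b.
have cF1 : continuous F1 by exact: cst_c.
have cF2 : continuous F2 by exact: continuous_lin.
have := pos_radon_le mu_pos f (fun b => C * k b + F2 b) cf (continuous_lin C k F2 ck cF2).
rewrite (pos_radon_lin mu_pos)// (pos_radon_lin mu_pos L g)// (mu_pos.2.1 eta _ (cst_c 1)).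
have le c : f c <= C * k c + F2 c by have := fL c; rewrite /F2 /F1; lra.
move=> /(_ le); have /(ler_wpM2l C0) := ltW muk; have /(ler_wpM2l L0) := mug.
by rewrite -/mu1; nra.
Qed.
End Support.

(** * Distance to a set and the collapsed metric *)

Section DistanceToSet.
Context {R : realType} {M : Type} {d : M -> M -> R} {A : set M} {z : M}.
Hypotheses (dm : is_metric d) (Az : A z).

Definition dist (x : M) : R := inf [set d x a | a in A].

Lemma dist_le x a : A a -> dist x <= d x a.
Proof.
move=> Aa; apply: (@inf_le_mem _ _ 0); last by exists a.
by move=> _ [b _ <-]; exact: dm.1.
Qed.

Lemma le_dist x (c : R) : (forall a, A a -> c <= d x a) -> c <= dist x.
Proof.
move=> h; apply: lb_le_inf; first by exists (d x z), z.
by move=> _ [a Aa <-]; exact: h.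
Qed.

Lemma dist_ge0 x : 0 <= dist x.
Proof. by apply: le_dist => a _; exact: dm.1. Qed.

Lemma dist_mem a : A a -> dist a = 0.
Proof.
move=> Aa; apply/eqP; rewrite eq_le dist_ge0 andbT.
by have <- : d a a = 0; [apply/dm.2.1|exact: dist_le].
Qed.

Lemma dist_lip x y : dist x <= d x y + dist y.
Proof.
rewrite -lerBlDl; apply: le_dist => a Aa; rewrite lerBlDl.
by apply: le_trans (dist_le _ _ Aa) _; exact: dm.2.2.2.
Qed.

(* [d * shortcut] is the pseudometric obtained from [d] by collapsing [A] to a point. *)
Definition shortcut (x y : M) : R := Num.min (d x y) (dist x + dist y) / d x y.

Lemma shortcut_ge0 x y : 0 <= shortcut x y.
Proof. by rewrite divr_ge0 ?le_min ?addr_ge0 ?dist_ge0 ?dm.1. Qed.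

Lemma shortcut_mem a b : A a -> A b -> shortcut a b = 0.
Proof.
move=> Aa Ab; rewrite /shortcut !dist_mem// addr0.
by rewrite (min_idPr _) ?mul0r// dm.1.
Qed.

(** The quotient is [min (1, (dist x + dist y) / d x y)]; an upper bound on [d x y] keeps its second
    entry away from 0, which is why finite distances matter. *)
Lemma le_shortcut (e N : R) x y : x <> y -> 0 <= e -> d x y <= N ->
  e <= dist x \/ e <= dist y -> Num.min 1 (e / N) <= shortcut x y.
Proof.
move=> xy e0 dN exy; have d_gt0 := metric_gt0 dm _ _ xy.
have N0 : 0 < N by exact: lt_le_trans dN.
have eS : e <= dist x + dist y.
  by have := dist_ge0 x; have := dist_ge0 y; case: exy; lra.
set m := Num.min _ _; have m1 : m <= 1 by rewrite ge_min lexx.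
have mN : m * N <= e by rewrite -ler_pdivlMr// ge_min lexx orbT.
have m0 : 0 <= m by rewrite le_min ler01 divr_ge0// ltW.
rewrite /shortcut ler_pdivlMr// le_min; apply/andP; split.
  by rewrite ler_piMl// ltW.
by apply: le_trans eS; apply: le_trans mN; rewrite ler_wpM2l.
Qed.

Lemma tilde_bounded_shortcut : tilde_bounded shortcut.
Proof.
exists 1 => x y xy; rewrite ger0_norm ?shortcut_ge0//.
by rewrite ler_pdivrMr ?(metric_gt0 dm)// mul1r ge_min lexx.
Qed.

Lemma tilde_continuous_shortcut : tilde_continuous d shortcut.
Proof.
move=> x y xy V nV; have [_ [_ [dsym tri]]] := dm.
pose phi (p : R * R) : R := Num.min p.1 p.2 / p.1.
have cphi : phi @ (d x y, dist x + dist y) --> phi (d x y, dist x + dist y).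
  apply: cvgM; first by apply: (@continuous_min R _ fst snd); [exact: cvg_fst|exact: cvg_snd].
  by apply: cvgV; [rewrite gt_eqF// (metric_gt0 dm)|exact: cvg_fst].
have /cphi/nbhs_ballP[e /= e0 eV] := nV.
(* Both arguments of [phi] change by at most [d x x' + d y y']. *)
exists (e / 2); first by rewrite divr_gt0.
move=> x' y' _ xx' yy'; apply: (eV (d x' y', dist x' + dist y')).
have h1 := dist_lip x x'; have h2 := dist_lip x' x.
have h3 := dist_lip y y'; have h4 := dist_lip y' y.
have t1 := tri x x' y; have t2 := tri x' y' y; have t3 := tri x' x y'; have t4 := tri x y y'.
have s1 := dsym x x'; have s2 := dsym y y'.
by split; rewrite /ball/= ltr_norml; apply/andP; split; lra.
Qed.

(** Compare the branches of the minima: two direct steps use the triangle inequality, a mixed pair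
    uses that [dist] is 1-Lipschitz, and two steps through [A] use [0 <= dist u]. *)
Lemma shortcut_triangle x u y : x <> u -> u <> y -> x <> y ->
  d x y * shortcut x y <= d x u * shortcut x u + d u y * shortcut u y.
Proof.
move=> xu uy xy; have [_ [_ [dsym tri]]] := dm.
have E a b : a <> b -> d a b * shortcut a b = Num.min (d a b) (dist a + dist b).
  by move=> ab; rewrite /shortcut mulrC divfK// gt_eqF// (metric_gt0 dm).
rewrite !E//.
have h1 := dist_lip x u; have h2 := dist_lip y u; have s2 := dsym u y.
have h3 := tri x u y; have h4 := dist_ge0 u.
by rewrite !minEle; do !case: ifPn => ?; lra.
Qed.

End DistanceToSet.

(** * Separation in the Samuel compactification, and the support inclusion *)

Lemma samuel_separation {R : realType} {M : Type} {d : M -> M -> R} {A : set M}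
  {U : topologicalType} {j : M -> U} (u : U) : is_samuel d j -> ~ closure (j @` A) u ->
  exists h : U -> R, exists e, [/\ continuous h, 0 < e, h u = 1 &
    forall x a, A a -> 1 / 2 < h (j x) -> e <= d x a].
Proof.
move=> [cU [hU [_ [_ [uc _]]]]] Au.
have clu : closed [set u] by apply: accessible_closed_set1; exact: hausdorff_accessible.
have dis : closure (j @` A) `&` [set u] = set0.
  by rewrite -subset0 => v [Fv /= vu]; apply: Au; rewrite -vu.
have clA : closed (closure (j @` A)) by exact: closed_closure.
have nU : normal_space U by exact: compact_normal.
(* Uniform continuity of [h \o j] turns this topological separation into a positive metric distance
   from [A]. *)
have [h [ch hA hu _]] := @urysohn_ext_itv U R nU _ _ 0 1 clA clu dis ltr01.
have [|e e0 he] := uc h ch (1 / 2); first by lra.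
exists h, e; split => // [|x a Aa hx].
  by apply: hu; exists u.
rewrite leNgt; apply/negP => /he /=.
have -> : h (j a) = 0 by apply: hA; exists (j a) => //; apply: subset_closure; exists a.
by rewrite subr0; have := ler_norm (h (j x)); lra.
Qed.

Theorem theorem4p3 (R : realType) (M : Type) (d : M -> M -> R) (z : M)
  (B : topologicalType) (iota : M -> M -> B)
  (U : topologicalType) (j : M -> U)
  (dB : B -> \bar R) (Phi : (M -> R) -> (B -> R)) (p1 p2 : B -> U)
  (mu : (B -> R) -> R) :
  is_metric d -> metric_complete d ->
  (exists x u y : M, [/\ x <> u, u <> y & x <> y]) ->
  is_stone_cech d iota -> is_samuel d j ->
  (* dB : the continuous extension of d to beta Mtilde, with values in [0,oo] *)
  continuous dB -> (forall x y, x <> y -> dB (iota x y) = (d x y)%:E) ->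
  (* Phi f : the continuous extension of the difference quotient of f *)
  (forall f, Lip0 d z f -> continuous (Phi f) /\
     forall x y, x <> y -> Phi f (iota x y) = (f x - f y) / d x y) ->
  (* p1, p2 : extensions of the coordinate projections *)
  continuous p1 -> continuous p2 ->
  (forall x y, x <> y -> p1 (iota x y) = j x /\ p2 (iota x y) = j y) ->
  pos_radon mu -> Gminimal d iota mu -> concentrated_finite dB mu ->
  (p1 @` supp mu) `|` (p2 @` supp mu)
    `<=` esupp d z j (fun f => mu (Phi f)) `|` [set j z].
Proof.
move=> dm _ M3 sc sam cdB dBE Phi_ext cp1 cp2 pE mu_pos mu_min mu_fin.
(* Both projections are treated at once: it is enough that [p] sends each pair to the image of one
   of its coordinates. *)
suff main p : continuous p ->
    (forall x y, x <> y -> p (iota x y) = j x \/ p (iota x y) = j y) ->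
    p @` supp mu `<=` esupp d z j (fun f => mu (Phi f)) `|` [set j z].
  by rewrite subUset; split; apply: main => // x y /pE[]; [left|right].
move=> cp pj _ [b mub <-].
have [->|pbz] := pselect (p b = j z); first by right.
left=> A0 muA0; apply: contrapT => A0b.
(* Adding the base point enlarges the closure only by [j z], which [p b] avoids, and makes the
   distance to [A] meaningful even if [A0] is empty. *)
pose A := A0 `|` [set z].
have Az : A z by right.
have Ab : ~ closure (j @` A) (p b).
  rewrite image_setU closureU image_set1 => -[//|].
  rewrite -(closure_id _).1; first exact: pbz.
  by apply: accessible_closed_set1; apply: hausdorff_accessible; exact: sam.2.1.
have muA f : Lip0 d z f -> (forall a, A a -> f a = 0) -> mu (Phi f) = 0.
  by move=> Lf fA; apply: muA0 => // a A0a; apply: fA; left.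
have [h [e [ch e0 hb hA]]] := samuel_separation (p b) sam Ab.
have [H [cH HE]] := sc.2.2.2.2 _ (@tilde_bounded_shortcut _ _ _ A _ dm Az)
  (tilde_continuous_shortcut dm Az).
have GH : Gset d iota H.
  by split => // x u y xu uy xy; rewrite !HE//; exact: (shortcut_triangle dm Az).
have H0 c : 0 <= H c.
  apply: (stone_cech_ge sc setT) => // [|x y xy _]; first exact: openT.
  by rewrite HE//; exact: (shortcut_ge0 dm Az).
have muH : mu H <= 0.
  apply: (Gminimal_nonpos dm sc Phi_ext _ A) => // a a' Aa Aa' aa'.
  by rewrite HE// (shortcut_mem dm Az).
pose V := (h \o p) @^-1` [set r | 1 / 2 < r].
have oV : open V.
  apply: open_comp; last exact: open_gt.
  by move=> x _; apply: continuous_comp; [exact: cp|exact: ch].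
suff : supp mu `&` V = set0.
  by rewrite -subset0 => /(_ b); apply; split => //; rewrite /V/= hb; lra.
apply: (supp_disjoint dB mu H V sc.1 mu_pos mu_fin cH H0 muH oV) => c Vc dc.
(* On the neighbourhood of [c] inside [V] where [dB < N], pairs of points satisfy the uniform bound
   of [le_shortcut], which density carries over to [c]. *)
have [N N0 dN] : exists2 N : R, 0 < N & (dB c < N%:E)%E.
  case: (dB c) dc => [r _|//|_]; last by exists 1; rewrite ?ltNyr.
  by exists (`|r| + 1); rewrite ?lte_fin; have := ler_norm r; have := normr_ge0 r; lra.
have m0 : 0 < Num.min 1 (e / N) by rewrite lt_min ltr01 divr_gt0.
apply: (lt_le_trans m0).
apply: (stone_cech_ge sc (V `&` dB @^-1` [set y | (y < N%:E)%E])) => //.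
  apply: openI => //; apply: open_comp; last exact: open_ereal_lt_ereal.
  by move=> x _; exact: cdB.
move=> x y xy [Vxy]; rewrite /= dBE// lte_fin => dxy.
rewrite HE//; apply: (le_shortcut dm Az) => //; [exact: ltW|exact: ltW|].
by case: (pj x y xy) Vxy => E; rewrite /V/= E => hx; [left|right];
  apply: (le_dist Az) => a Aa; exact: hA.
Qed.
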